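(* Let $F$ be an algebraically closed field of characteristic $p>0$ and let $k$ be a positive integer. There exist a sequence of finite groups $G_i$, $i\in\mathbb{N}$, and irreducible faithful $FG_i$-modules $M_i$ such that: (1) $\lim_{i\to\infty}\dim M_i=\infty$; (2) $\dim H^k(G_i,M_i)\ge e\,(\dim M_i)^{k-1}$ for all $i$, for some constant $e=e(k,p)>0$; and (3) if $k\ge 3$, then $\displaystyle\lim_{i\to\infty}\frac{\dim H^k(G_i,M_i)}{\dim M_i}=\infty$.
   Context: An $FG$-module $M$ is called faithful if $G$ acts faithfully on $M$. All dimensions are over $F$. *)

(* Defs.v *)
From HB Require Import structures.
From mathcomp Require Import all_boot all_order all_algebra all_fingroup.
From mathcomp Require Import mxrepresentation zify.

Set Implicit Arguments.
Unset Strict Implicit.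
Unset Printing Implicit Defensive.

Import GRing.Theory.
Local Open Scope ring_scope.

(* Cohomology H^n(G, M) of a finite group G by inhomogeneous cochains, where  *)
(* M is the FG-module 'rV[F]_d of a representation rG of G.  As usual in      *)
(* mxrepresentation, x \in G acts on the right, v |-> v *m rG x, so the       *)
(* coboundary is that of the bar complex for right modules: it is the         *)
(* textbook one, read from right to left.                                     *)

(* face j (g_0, ..., g_n) drops g_0 if j = 0, drops g_n if j = n+1, and       *)
(* multiplies the neighbours g_(j-1) and g_j otherwise.                       *)
Definition face (T : finGroupType) (n j : nat) (g : {ffun 'I_n.+1 -> T}) :
    {ffun 'I_n -> T} :=
  [ffun i : 'I_n =>
     let x := g (widen_ord (leqnSn n) i) in let y := g (lift ord0 i) in
     if (i.+1 < j)%N then x else if i.+1 == j then (x * y)%g else y].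

Lemma face_face (T : finGroupType) n i j (g : {ffun 'I_n.+2 -> T}) :
  (j <= i)%N -> face j (face i.+1 g) = face i (face j g).
Proof.
move=> le_ji; apply/ffunP=> l; rewrite !ffunE /=.
have -> : widen_ord (leqnSn n.+1) (lift ord0 l)
        = lift ord0 (widen_ord (leqnSn n) l) by apply: val_inj.
rewrite /bump /= !add1n.
case: (ltngtP l.+1 j); case: (ltngtP l.+2 j); case: (ltngtP l.+1 i);
 case: (ltngtP l.+2 i.+1); case: (ltngtP l.+1 i.+1); rewrite ?mulgA //; lia.
Qed.

Section Cohomology.

Variables (F : fieldType) (gT : finGroupType) (G : {group gT}) (d : nat).
Variable rG : mx_representation F G d.

Definition cochain (n : nat) : Type :=
  {ffun {ffun 'I_n -> subg_of G} -> 'rV[F]_d}.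

HB.instance Definition _ n := Vector.on (cochain n).

Definition coboundary (n : nat) (f : cochain n) : cochain n.+1 :=
  [ffun g : {ffun 'I_n.+1 -> subg_of G} =>
     \sum_(j < n.+1) (-1) ^+ j *: f (face j g)
       + (-1) ^+ n.+1 *: (f (face n.+1 g) *m rG (sgval (g ord_max)))].

Lemma coboundary_linear n : linear (@coboundary n).
Proof.
move=> a f1 f2; apply/ffunP=> g; rewrite !ffunE.
rewrite mulmxDl -scalemxAl !scalerDr scaler_sumr addrACA -big_split /=.
congr (_ + (_ + _)); last by rewrite !scalerA mulrC.
by apply: eq_bigr => j _; rewrite !ffunE scalerDr !scalerA mulrC.
Qed.

HB.instance Definition _ n :=
  GRing.isLinear.Build F (cochain n) (cochain n.+1) *:%R (@coboundary n)
    (@coboundary_linear n).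

(* The coface maps, as a way to prove that coboundary squares to zero. *)
Definition coface n j (f : cochain n) : cochain n.+1 :=
  [ffun g : {ffun 'I_n.+1 -> subg_of G} =>
   f (face j g) *m (if j == n.+1 then rG (sgval (g ord_max)) else 1%:M)].

Lemma coboundaryE n (f : cochain n) :
  coboundary f = \sum_(j < n.+2) (-1) ^+ j *: coface j f.
Proof.
apply/ffunP=> g; rewrite big_ord_recr /= !ffunE sum_ffunE eqxx; congr (_ + _).
by apply: eq_bigr => j _; rewrite !ffunE ltn_eqF // mulmx1.
Qed.

Lemma coface_linear n j : linear (@coface n j).
Proof.
by move=> a f1 f2; apply/ffunP=> g; rewrite !ffunE mulmxDl -scalemxAl.
Qed.

HB.instance Definition _ n j :=
  GRing.isLinear.Build F (cochain n) (cochain n.+1) *:%R (@coface n j)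
    (@coface_linear n j).

Lemma coface_comm n i j (f : cochain n) : (j <= i <= n.+1)%N ->
  coface i.+1 (coface j f) = coface j (coface i f).
Proof.
case/andP=> ji iN; apply/ffunP=> g; rewrite !ffunE face_face // -!mulmxA.
congr (_ *m _).
have -> : (j == n.+2) = false by lia.
have lm : lift ord0 ord_max = ord_max :> 'I_n.+2 by apply: val_inj.
rewrite mulmx1 eqSS.
have [-> | ne] := eqVneq i n.+1; last first.
  rewrite (_ : (j == n.+1) = false) ?eqSS ?(negbTE ne) ?mulmx1 //; lia.
rewrite /= lm eqxx.
have [-> | ne] := eqVneq j n.+1; last first.
  have -> : (n.+1 < j)%N = false by lia.
  by rewrite mul1mx.
by rewrite ltnn ltnSn -repr_mxM ?subgP.
Qed.

Lemma coboundary_coboundary n (f : cochain n) : coboundary (coboundary f) = 0.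
Proof.
rewrite [coboundary f]coboundaryE coboundaryE.
pose B i j := (-1) ^+ (i + j) *: coface i (coface j f).
transitivity (\sum_(i < n.+3) \sum_(j < n.+2) B i j).
  apply: eq_bigr => i _; rewrite linear_sum scaler_sumr /=.
  by apply: eq_bigr => j _; rewrite linearZ /= scalerA -exprD.
under eq_bigr => i _ do rewrite (bigID (fun j : 'I_n.+2 => j < i)%N) /=.
rewrite big_split /= [X in _ + X]big_ord_recr /=.
rewrite [X in _ + (_ + X)]big1 ?addr0; last by move=> j; rewrite ltn_ord.
rewrite (exchange_big_dep predT) //= -big_split big1 //= => j _.
rewrite big_mkcond big_ord_recl /= add0r -big_mkcond /=.
under [X in _ + X]eq_bigl do rewrite -leqNgt.
rewrite -big_split big1 //= => i; rewrite /bump /= add1n ltnS => ji.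
rewrite /B coface_comm ?ji -1?ltnS ?ltn_ord //.
by rewrite addSn exprS mulN1r scaleNr addnC addNr.
Qed.

Definition cocycles (n : nat) : {vspace cochain n} :=
  lker (linfun (@coboundary n)).

Definition coboundaries (n : nat) : {vspace cochain n} :=
  match n with
  | 0 => 0%VS
  | m.+1 => limg (linfun (@coboundary m))
  end.

Lemma coboundaries_sub n : (coboundaries n <= cocycles n)%VS.
Proof.
case: n => [|n]; first exact: sub0v.
apply/subvP=> _ /memv_imgP[f _ ->]; rewrite memv_ker !lfunE /=.
by rewrite coboundary_coboundary.
Qed.

(* The subtraction is not truncated, by coboundaries_sub. *)
Definition dim_cohomology (n : nat) : nat :=
  (\dim (cocycles n) - \dim (coboundaries n))%N.

End Cohomology.

(* Main.v *)
Require Import Defs.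
From HB Require Import structures.
From mathcomp Require Import all_boot all_order all_algebra all_fingroup.
From mathcomp Require Import mxrepresentation zify.
From mathcomp Require Import classical_sets reals topology normedtype.

Set Implicit Arguments.
Unset Strict Implicit.
Unset Printing Implicit Defensive.

Import Order.TTheory GRing.Theory Num.Theory.
Import numFieldNormedType.Exports.
Local Open Scope ring_scope.

(**
  The heart of the permutation module F^n with p | n is the space of vectors
  of coordinate sum 0 modulo the constant ones. It is irreducible and faithful
  for S_n (n >= 5), and H^1(S_n, heart) is nonzero: a coordinate vector e has
  sum 1, so g |-> e g - e is a cocycle with values in the heart. If it were the
  coboundary of v, then e - v would be fixed by S_n modulo constants, hence
  constant, hence of sum 0; but e - v has sum 1.

  Take blocks {(a, b)} x {0, ..., 3p-1} indexed by A x F_p, where A is a finite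
  group, and let G consist of the permutations
    (a, b, y) |-> (a s, b + t a, pi_(a,b) y),   s in A, t : A -> F_p.
  The module M is the direct sum of the hearts of the blocks; its dimension d
  is |A| p (3p - 2). It is induced from the stabiliser of a block, it is
  faithful, and it is irreducible since G permutes the blocks transitively and
  contains all transpositions inside a block (heart_faithful,
  heart_irreducible).

  The stabiliser of a block has an elementary abelian p-quotient of rank about
  |A|, and by Shapiro's lemma this makes H^k(G, M) large. Concretely, each c in
  A gives a self-extension of M: the derivation T_c multiplies the action of g
  on the block (a, b) by the number t(c a) taken from g. Cup product with a
  derivation preserves cocycles (coboundary_cup), so the cocycle of the heart
  and k-1 derivations give a k-cocycle
    (g_1, ..., g_k) |-> beta(g_1) T_(c_1)(g_2) ... T_(c_(k-1))(g_k).
  To see that these classes are independent, evaluate at the commuting elements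
  (l, e_1, ..., e_(k-1)), where l is a transposition of the block (1, 0) and
  e_j adds 1 to the F_p-coordinate of the points over b_j <> 1 in A, then take
  the alternating sum over all orders and the component in the block (1, 0),
  on which every e_j acts trivially. A coboundary is sent to w (1 - l) with w
  independent of l (alternation_coboundary), whereas the class of c is sent to
  beta(l) if c = b and to 0 otherwise (alternation_cup_class). As beta does not
  bound on the symmetric group of the block, the coefficient of b vanishes.

  With A = Z/k x Z/(i+1), letting c_j range over the coset {j} x Z/(i+1)
  yields (i+1)^(k-1) classes, while d is k p (3p - 2) (i+1): this is (2) with
  e = (k p (3p - 2))^(1-k). For k >= 3, (3) follows from (1) and (2).
*)

(** * Cup products with derivations *)

Section CupProduct.

Variables (F : fieldType) (gT : finGroupType) (G : {group gT}) (d : nat).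
Variable rG : mx_representation F G d.

(** Equivalently, the block triangular matrices with rG g twice on the diagonal
    and T g above it form a representation: a self-extension of rG. *)
Definition mx_derivation (T : subg_of G -> 'M[F]_d) :=
  forall g h, T (g * h)%g = T g *m rG (sgval h) + rG (sgval g) *m T h.

Definition cup n (f : cochain F G d n) (T : subg_of G -> 'M[F]_d) :
    cochain F G d n.+1 :=
  [ffun g : {ffun 'I_n.+1 -> subg_of G} =>
     f (face n.+1 g) *m T (g ord_max)].

Lemma cupE n (f : cochain F G d n) T g :
  cup f T g = f (face n.+1 g) *m T (g ord_max).
Proof. by rewrite ffunE. Qed.

Lemma face_last (T : finGroupType) n (g : {ffun 'I_n.+1 -> T}) i :
  face n.+1 g i = g (widen_ord (leqnSn n) i).
Proof. by rewrite ffunE ltnS ltn_ord. Qed.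

(** All faces but the last two leave the last entry alone. The terms of the last
    two contain f (...) T(x y) - f (...) T(x) y = f (...) x T(y), which is the
    last face of the coboundary of f, multiplied by T(y). *)
Lemma coboundary_cup n (f : cochain F G d n) T : mx_derivation T ->
  coboundary rG (cup f T) = cup (coboundary rG f) T.
Proof.
move=> derT; apply/ffunP=> g.
rewrite ffunE big_ord_recr /= !cupE [in RHS]ffunE.
have lastS : lift ord0 ord_max = ord_max :> 'I_n.+2 by apply: val_inj.
set y := g ord_max; set x := g (widen_ord (leqnSn n.+1) ord_max).
have face_max j : (j < n.+1)%N -> face j g ord_max = y.
  by move=> lt_j; rewrite ffunE /= lastS ltnNge ltnW //= gtn_eqF.
have -> : face n.+1 g ord_max = (x * y)%g.
  by rewrite ffunE /= lastS ltnn eqxx.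
have -> : face n.+2 g ord_max = x by rewrite face_last.
rewrite -face_face // derT mulmxDl mulmx_suml mulmxDr !mulmxA scalerDr.
rewrite -scalemxAl -addrA; congr (_ + _).
  apply: eq_bigr => j _; rewrite cupE face_max // -scalemxAl.
  by rewrite face_face // -ltnS ltnW // ltnS.
rewrite [_ + (-1) ^+ n.+1 *: (_ *m T y)]addrC -addrA.
by rewrite (exprS _ n.+1) mulN1r scaleNr subrr addr0.
Qed.

End CupProduct.

(** * Alternating evaluation of cochains *)

Section Alternation.

Variables (F : fieldType) (gT : finGroupType) (G : {group gT}) (d : nat).
Variable rG : mx_representation F G d.

Definition alternation n (f : cochain F G d n) (x : 'I_n -> subg_of G) :
    'rV[F]_d :=
  \sum_(s : 'S_n) (-1) ^+ s *: f [ffun i => x (s i)].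

Lemma alternation_sum n (I : finType) (a : I -> F)
    (f : I -> cochain F G d n) x :
  alternation (\sum_i a i *: f i) x = \sum_i a i *: alternation (f i) x.
Proof.
under [RHS]eq_bigr do rewrite scaler_sumr.
rewrite exchange_big; apply: eq_bigr => s _ /=.
rewrite sum_ffunE scaler_sumr; apply: eq_bigr => i _.
by rewrite ffunE !scalerA mulrC.
Qed.

(** Even and odd permutations are paired off, since the terms must cancel in
    characteristic 2 too. *)
Lemma alternating_sum_eq0 n (V : lmodType F) (H : 'S_n -> V) (i j : 'I_n) :
  i != j -> (forall s, H (tperm i j * s)%g = H s) ->
  \sum_(s : 'S_n) (-1) ^+ s *: H s = 0.
Proof.
move=> neq_ij symH; pose t := tperm i j.
have oddMt s : (t * s)%g = ~~ s :> bool by rewrite odd_permM odd_tperm neq_ij.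
rewrite (bigID (@odd_perm _)) /=.
apply: canLR (subrK _) _; rewrite add0r -sumrN.
rewrite (reindex_inj (mulgI t)); apply: eq_big => //= s.
by rewrite oddMt => /negPf->; rewrite symH scaleN1r scale1r.
Qed.

(** An inner face multiplies two neighbours, which commute, so its alternating
    sum cancels. The last face is the first one up to a cyclic rotation, whose
    sign makes the two combine into the factor 1 - x. *)
Lemma alternation_coboundary n (h : cochain F G d n)
    (x : 'I_n.+1 -> subg_of G) :
    (forall i j, commute (x i) (x j)) ->
  alternation (coboundary rG h) x =
    \sum_(s : 'S_n.+1) (-1) ^+ s *:
      (h [ffun i => x (s (lift ord0 i))] *m
         (1%:M - rG (sgval (x (s ord0))))).
Proof.
move=> commx; rewrite /alternation.
have face0 (s : 'S_n.+1) :
    face 0 [ffun i => x (s i)] = [ffun i => x (s (lift ord0 i))].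
  by apply/ffunP=> i; rewrite !ffunE.
have inner (j : 'I_n) : \sum_(s : 'S_n.+1)
    (-1) ^+ s *: h (face j.+1 [ffun i => x (s i)]) = 0.
  pose i1 := widen_ord (leqnSn n) j; pose i2 := lift ord0 j.
  have neq_i12 : i1 != i2 by rewrite -val_eqE /= /bump /= add1n neq_ltn leqnn.
  apply: (alternating_sum_eq0 neq_i12) => s; congr (h _).
  apply/ffunP=> l; rewrite !ffunE !permM eqSS ltnS.
  case: (ltngtP l j) => [lt_lj | lt_jl | eq_lj] /=.
  - by rewrite tpermD // -val_eqE /= /bump /= ?add1n gtn_eqF // ltnW.
  - by rewrite tpermD // -val_eqE /= /bump /= ?add1n ltn_eqF // ltnW.
  have -> : l = j by apply: val_inj.
  by rewrite tpermL tpermR; apply: commx.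
transitivity (
   \sum_(s : 'S_n.+1) (-1) ^+ s *: h [ffun i => x (s (lift ord0 i))] +
   \sum_(s : 'S_n.+1) (-1) ^+ s *: ((-1) ^+ n.+1 *:
      (h (face n.+1 [ffun i => x (s i)]) *m rG (sgval (x (s ord_max)))))).
  under eq_bigr => s _ do
    rewrite ffunE scalerDr big_ord_recl expr0 scale1r face0 scalerDr ffunE.
  rewrite !big_split /= -[RHS]addr0 -!addrA; congr (_ + _).
  rewrite addrC; congr (_ + _).
  under eq_bigr do rewrite scaler_sumr.
  rewrite exchange_big big1 // => j _ /=.
  under eq_bigr => s _ do rewrite scalerA mulrC -scalerA.
  by rewrite -scaler_sumr inner scaler0.
under [RHS]eq_bigr do rewrite mulmxBr scalerBr mulmx1.
rewrite sumrB; congr (_ + _); rewrite -sumrN.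
(* The rotation i |-> i + 1 of the indices 0, ..., n is a cycle of sign
   (-1)^n. *)
pose r : 'S_n.+1 := lift_perm ord_max ord0 1.
have r_max : r ord_max = ord0 by rewrite lift_perm_id.
have r_widen i : r (widen_ord (leqnSn n) i) = lift ord0 i.
  have -> : widen_ord (leqnSn n) i = lift ord_max i.
    by apply: val_inj; rewrite /= /bump leqNgt ltn_ord.
  by rewrite lift_perm_lift perm1.
have sgn_r (s : 'S_n.+1) : (-1) ^+ (r * s)%g = (-1) ^+ n * (-1) ^+ s :> F.
  by rewrite odd_permM odd_lift_perm odd_perm1 !addbF signr_addb signr_odd.
rewrite (reindex_inj (mulgI r)); apply: eq_bigr => s _.
rewrite sgn_r permM r_max scalerA -scaleNr; congr (_ *: (h _ *m _)).
  by rewrite exprS mulN1r mulrN -mulrA mulrCA -expr2 sqrr_sign mulr1.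
by apply/ffunP=> i; rewrite face_last !ffunE permM r_widen.
Qed.

End Alternation.

(** * Lower bounds for the dimension of cohomology *)

Lemma dim_cohomology_ge (F : fieldType) (gT : finGroupType) (G : {group gT})
    (d : nat) (rG : mx_representation F G d) n (I : finType)
    (f : I -> cochain F G d n.+1) :
    (forall i, coboundary rG (f i) = 0) ->
    (forall a h, \sum_i a i *: f i = coboundary rG h -> forall i, a i = 0) ->
  (#|I| <= dim_cohomology rG n.+1)%N.
Proof.
move=> cycf indf.
pose X := [tuple f (enum_val i) | i < #|I|].
have sumX (k : 'I_#|I| -> F) :
    \sum_(i < #|I|) k i *: X`_i = \sum_i k (enum_rank i) *: f i.
  rewrite (reindex _ (onW_bij _ (enum_rank_bij I))); apply: eq_bigr => i _.
  by rewrite -tnth_nth tnth_mktuple enum_rankK.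
have indX (k : 'I_#|I| -> F) h :
    \sum_(i < #|I|) k i *: X`_i = coboundary rG h -> forall i, k i = 0.
  by rewrite sumX => /indf k0 i; rewrite -[i]enum_valK k0.
have freeX : free X by apply/freeP=> k k0; apply: (indX _ 0); rewrite linear0.
have capXB : (<<X>> :&: coboundaries rG n.+1 = 0)%VS.
  apply/eqP; rewrite -subv0; apply/subvP=> v; rewrite memv_cap => /andP[vX].
  case/memv_imgP=> h _; rewrite lfunE /= memv0 => def_v.
  rewrite (coord_span vX) big1 // => i _.
  by rewrite (indX (coord X ^~ v) h) ?scale0r // -def_v -coord_span.
rewrite /dim_cohomology -(size_tuple X) -(eqP freeX).
rewrite leq_subRL ?dimvS ?coboundaries_sub // addnC.
rewrite -dimv_disjoint_sum // dimvS // subv_add coboundaries_sub andbT.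
apply/span_subvP=> v /mapP[i _ ->].
by rewrite memv_ker lfunE /= cycf.
Qed.

(** * The sum of the hearts of the blocks *)

Section Heart.

Variables (F : fieldType) (X : finType) (q : nat).
Hypothesis q2F : q.+2%:R = 0 :> F.

Local Notation Z := (X * 'I_q.+2)%type.
Local Notation dimH := #|{: X * 'I_q}|.
Implicit Types (phi psi : X -> F) (g h : {perm Z}) (v : {ffun Z -> F^o}).

Definition sum_zero v := forall x, \sum_y v (x, y) = 0.
Definition block_const v := forall x y y', v (x, y) = v (x, y').

(** Coordinates on the vectors of block sums 0 modulo those constant on blocks:
    the values in a block relative to its point 1. The point 0 is left out, as
    the vanishing of the sum determines its value. *)
Definition heart_proj v : 'rV[F]_dimH :=
  \row_j (v ((enum_val j).1, lift ord0 (lift ord0 (enum_val j).2))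
          - v ((enum_val j).1, lift ord0 ord0)).

(** The representative that vanishes at the point 1 of each block. *)
Definition heart_lift_at (w : 'rV[F]_dimH) (z : Z) : F :=
  if unlift ord0 z.2 is Some y then
    if unlift ord0 y is Some j then w 0 (enum_rank (z.1, j)) else 0
  else - \sum_j w 0 (enum_rank (z.1, j)).

Definition heart_lift w : {ffun Z -> F^o} := [ffun z => heart_lift_at w z].

Lemma heart_liftK : cancel heart_lift heart_proj.
Proof.
move=> w; apply/rowP=> j; rewrite !mxE !ffunE /heart_lift_at /=.
rewrite !liftK unlift_none subr0.
by rewrite -surjective_pairing enum_valK.
Qed.

Lemma sum_zero_lift w : sum_zero (heart_lift w).
Proof.
move=> x; rewrite !big_ord_recl !ffunE /heart_lift_at /=.
rewrite unlift_none liftK unlift_none add0r.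
rewrite addrC; apply/eqP; rewrite subr_eq0; apply/eqP.
by apply: eq_bigr => j _; rewrite ffunE /heart_lift_at /= !liftK.
Qed.

Lemma heart_proj_const v : block_const v -> heart_proj v = 0.
Proof.
by move=> cv; apply/rowP=> j; rewrite !mxE (cv _ _ (lift ord0 ord0)) subrr.
Qed.

(** If v takes the value c at the points 1, ..., q+1 of a block, then it takes
    the value - (q+1) c = c at 0, by q2F. *)
Lemma heart_proj_eq0 v : sum_zero v -> heart_proj v = 0 -> block_const v.
Proof.
move=> v0 pv0 x; pose c := v (x, lift ord0 ord0).
have vj j : v (x, lift ord0 (lift ord0 j)) = c.
  have /rowP/(_ (enum_rank (x, j))) := pv0.
  by rewrite !mxE enum_rankK => /subr0_eq.
suffices vc y : v (x, y) = c by move=> y y'; rewrite !vc.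
case: (unliftP ord0 y) => [y1 ->|->].
  by case: (unliftP ord0 y1) => [j|] ->; rewrite ?vj.
have /eqP := v0 x; rewrite !big_ord_recl -/c.
rewrite (eq_bigr (fun=> c)) => [|j _]; last exact: vj.
rewrite sumr_const card_ord -mulrS -[c *+ _]mulr_natr.
have -> : q.+1%:R = -1 :> F by apply/eqP; rewrite -addr_eq0 natr1 q2F.
by rewrite mulrN1 subr_eq0 => /eqP.
Qed.

Lemma heart_proj_linear : linear heart_proj.
Proof.
by move=> a u v; apply/rowP=> j; rewrite !mxE !ffunE mulrBr opprD addrACA.
Qed.
HB.instance Definition _ :=
  GRing.isLinear.Build F {ffun Z -> F^o} 'rV[F]_dimH *:%R heart_proj
    heart_proj_linear.

Lemma heart_lift_linear : linear heart_lift.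
Proof.
move=> a u v; apply/ffunP=> z; rewrite !ffunE /heart_lift_at.
case: unlift => [y|]; last first.
  rewrite scalerN /GRing.scale /= mulr_sumr -opprD -big_split; congr (- _).
  by apply: eq_bigr => j _; rewrite !mxE.
by case: unlift => [j|]; rewrite ?mxE // /GRing.scale /= mulr0 addr0.
Qed.
HB.instance Definition _ :=
  GRing.isLinear.Build F 'rV[F]_dimH {ffun Z -> F^o} *:%R heart_lift
    heart_lift_linear.

(** Weighted permutation operators, with weights that depend on the block only.
    The action of the group (weight 1), the projections onto blocks and the
    derivations used for cup products all have this form. *)
Definition wperm phi g v : {ffun Z -> F^o} :=
  [ffun z => phi ((g^-1)%g z).1 * v ((g^-1)%g z)].

Lemma wperm_linear phi g : linear (wperm phi g).
Proof. by move=> a u v; apply/ffunP=> z; rewrite !ffunE mulrDr mulrCA. Qed.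
HB.instance Definition _ phi g :=
  GRing.isLinear.Build F {ffun Z -> F^o} {ffun Z -> F^o} *:%R (wperm phi g)
    (wperm_linear phi g).

Definition block_perm g := forall z z', ((g z).1 == (g z').1) = (z.1 == z'.1).
Definition on_blocks g x := (g (x, ord0)).1.

Lemma on_blocksE g z : block_perm g -> (g z).1 = on_blocks g z.1.
Proof. by move=> bg; apply/eqP; rewrite bg. Qed.

Lemma permV_eq g z z' : ((g^-1)%g z == z') = (z == g z').
Proof. by rewrite -(inj_eq (@perm_inj _ g)) permKV. Qed.

Lemma block_permV g : block_perm g -> block_perm g^-1.
Proof. by move=> bg z z'; rewrite -bg !permKV. Qed.

Lemma block_sumD (a : F) u v x :
  \sum_y (a *: u + v) (x, y) = a * (\sum_y u (x, y)) + \sum_y v (x, y).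
Proof.
rewrite mulr_sumr -big_split; apply: eq_bigr => y _.
by rewrite !ffunE /GRing.scale.
Qed.

Lemma block_sumB u v x :
  \sum_y (u - v) (x, y) = (\sum_y u (x, y)) - \sum_y v (x, y).
Proof. by rewrite -sumrB; apply: eq_bigr => y _; rewrite !ffunE. Qed.

Lemma sum_zeroB u v : sum_zero u -> sum_zero v -> sum_zero (u - v).
Proof. by move=> u0 v0 x; rewrite block_sumB u0 v0 subrr. Qed.

Lemma block_sum_wperm phi g v x : block_perm g ->
  let x' := on_blocks g^-1 x in
  \sum_y wperm phi g v (x, y) = phi x' * \sum_y v (x', y).
Proof.
move=> bg x'; have sumE (w : {ffun Z -> F^o}) x1 :
    \sum_y w (x1, y) = \sum_(z | z.1 == x1) w z.
  rewrite [RHS](reindex_onto (fun y => (x1, y)) snd) /=.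
    by apply: eq_bigl => y; rewrite !eqxx.
  by case=> x2 y /= /eqP->.
rewrite !sumE (reindex_inj (@perm_inj _ g)) mulr_sumr /=.
apply: eq_big => [z | z /eqP zx]; first by rewrite -bg permKV.
rewrite ffunE permK; congr (phi _ * _); apply/eqP.
by rewrite -bg zx permKV.
Qed.

Lemma sum_zero_wperm phi g v :
  block_perm g -> sum_zero v -> sum_zero (wperm phi g v).
Proof. by move=> bg v0 x; rewrite block_sum_wperm // v0 mulr0. Qed.

Lemma block_const_wperm phi g v :
  block_perm g -> block_const v -> block_const (wperm phi g v).
Proof.
move=> /block_permV bg cv x y y'; rewrite !ffunE.
have /eqP : ((g^-1)%g (x, y)).1 == ((g^-1)%g (x, y')).1 by rewrite bg.
case: ((g^-1)%g _) => a b; case: ((g^-1)%g _) => a' b' /= ->.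
by rewrite (cv _ b b').
Qed.

Lemma wpermM phi psi g h v : block_perm g ->
  wperm psi h (wperm phi g v)
    = wperm (fun x => phi x * psi (on_blocks g x)) (g * h)%g v.
Proof.
move=> bg; apply/ffunP=> z; rewrite !ffunE invMg permM -on_blocksE // permKV.
by rewrite mulrA [psi _ * _]mulrC.
Qed.

Definition heart_op phi g w := heart_proj (wperm phi g (heart_lift w)).

Lemma heart_op_linear phi g : linear (heart_op phi g).
Proof. by move=> a u v; rewrite /heart_op !linearP. Qed.
HB.instance Definition _ phi g :=
  GRing.isLinear.Build F 'rV[F]_dimH 'rV[F]_dimH *:%R (heart_op phi g)
    (heart_op_linear phi g).

Definition heart_mx phi g : 'M[F]_dimH := lin1_mx (heart_op phi g).

(** The operator preserves block sums 0 and constancy on blocks, so its matrix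
    does not depend on the representative. *)
Lemma heart_mxE phi g v : block_perm g -> sum_zero v ->
  heart_proj v *m heart_mx phi g = heart_proj (wperm phi g v).
Proof.
move=> bg v0; rewrite mul_rV_lin1 /= /heart_op; apply/eqP.
rewrite -subr_eq0 -linearB -linearB.
apply/eqP/heart_proj_const/block_const_wperm => //; apply: heart_proj_eq0.
  exact/sum_zeroB/v0/sum_zero_lift.
by rewrite linearB /= heart_liftK subrr.
Qed.

Lemma heart_mxP (A B : 'M[F]_dimH) :
  (forall v, sum_zero v -> heart_proj v *m A = heart_proj v *m B) -> A = B.
Proof.
move=> eqAB; apply/row_matrixP=> i; rewrite !rowE -[delta_mx _ _]heart_liftK.
by apply/eqAB/sum_zero_lift.
Qed.

Lemma heart_mxM phi psi g h : block_perm g -> block_perm h ->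
  heart_mx phi g *m heart_mx psi h
    = heart_mx (fun x => phi x * psi (on_blocks g x)) (g * h)%g.
Proof.
move=> bg bh; apply: heart_mxP => v v0.
have bgh : block_perm (g * h) by move=> z z'; rewrite !permM bh bg.
by rewrite mulmxA !heart_mxE ?wpermM //; apply: sum_zero_wperm.
Qed.

Lemma heart_mxD phi psi g :
  heart_mx (fun x => phi x + psi x) g = heart_mx phi g + heart_mx psi g.
Proof.
apply: heart_mxP => v v0; rewrite mulmxDr !mul_rV_lin1 /= /heart_op -linearD /=.
by congr heart_proj; apply/ffunP=> z; rewrite !ffunE mulrDl.
Qed.

Lemma heart_mx0 g : heart_mx (fun=> 0) g = 0.
Proof.
apply: heart_mxP => v _; rewrite mulmx0 mul_rV_lin1 -[RHS](linear0 heart_proj).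
by congr heart_proj; apply/ffunP=> z; rewrite !ffunE mul0r.
Qed.

Lemma heart_mx1 : heart_mx (fun=> 1) 1 = 1%:M.
Proof.
apply: heart_mxP => v v0; rewrite mulmx1 heart_mxE //; last first.
  by move=> z z'; rewrite !perm1.
by congr heart_proj; apply/ffunP=> z; rewrite ffunE mul1r invg1 perm1.
Qed.

Lemma eq_heart_mx phi psi g : phi =1 psi -> heart_mx phi g = heart_mx psi g.
Proof.
move=> eq_phi; apply: heart_mxP => v _; rewrite !mul_rV_lin1 /=.
by congr heart_proj; apply/ffunP=> z; rewrite !ffunE eq_phi.
Qed.

(** The projection of the module onto the summand of one block. *)
Definition block_proj x := heart_mx (fun x' => (x' == x)%:R) 1.

Lemma block_proj_eq0 x v : sum_zero v -> heart_proj v *m block_proj x = 0 ->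
  forall y y', v (x, y) = v (x, y').
Proof.
have b1 : block_perm 1 by move=> z z'; rewrite !perm1.
move=> v0; rewrite heart_mxE // => /heart_proj_eq0 cv y y'.
have := cv (sum_zero_wperm _ b1 v0) x y y'.
by rewrite !ffunE !invg1 !perm1 eqxx !mul1r.
Qed.

Lemma heart_mx_fix phi g x : block_perm g ->
    (forall y, g (x, y) = (x, y)) ->
  heart_mx phi g *m block_proj x = phi x *: block_proj x.
Proof.
move=> bg gx; have b1 : block_perm 1 by move=> z z'; rewrite !perm1.
rewrite heart_mxM // mulg1; apply: heart_mxP => v _.
rewrite -scalemxAr !mul_rV_lin1 /= /heart_op; move: (heart_lift _) => u.
rewrite -linearZ; congr heart_proj.
apply/ffunP=> z.
rewrite !ffunE -on_blocksE // permKV invg1 perm1 /GRing.scale /=.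
case: eqP => [zx | _]; last by rewrite mulr0 !mul0r mulr0.
have -> : (g^-1)%g z = z.
  by apply/eqP; rewrite permV_eq; case: z zx => x' y /= ->; rewrite gx.
by rewrite zx mulr1 mul1r.
Qed.

Section Representation.

Variable G : {group {perm Z}}.
Hypothesis blockG : {in G, forall g, block_perm g}.

Lemma heart_is_repr : mx_repr G (heart_mx (fun=> 1)).
Proof.
split=> [|g h Gg Gh]; first exact: heart_mx1.
rewrite heart_mxM; [|exact: blockG..].
by apply: eq_heart_mx => x; rewrite mulr1.
Qed.

Definition heart_repr := MxRepresentation heart_is_repr.

Lemma heart_reprE g v : g \in G -> sum_zero v ->
  heart_proj v *m heart_repr g = heart_proj [ffun z => v ((g^-1)%g z)].
Proof.
move=> Gg v0; rewrite heart_mxE //; last exact: blockG.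
congr heart_proj.
by apply/ffunP=> z; rewrite !ffunE mul1r.
Qed.

Hypothesis tpermG : forall x y y', tperm (x, y) (x, y') \in G.

Definition root_vec x (y y' : 'I_q.+2) : {ffun Z -> F^o} :=
  [ffun z => (z == (x, y))%:R - (z == (x, y'))%:R].

Lemma sum_zero_root x y y' : sum_zero (root_vec x y y').
Proof.
move=> x'; under eq_bigr do rewrite ffunE !xpair_eqE.
rewrite sumrB; case: eqP => _ /=; last by rewrite !big1 // subrr.
have sum1 (y1 : 'I_q.+2) : \sum_y2 (y2 == y1)%:R = 1 :> F.
  by rewrite (bigD1 y1) //= eqxx big1 ?addr0 // => i /negPf->.
by rewrite !sum1 subrr.
Qed.

Lemma wperm1E g v : wperm (fun=> 1) g v = [ffun z => v ((g^-1)%g z)].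
Proof. by apply/ffunP=> z; rewrite !ffunE mul1r. Qed.

Lemma exists_notin n (s : seq 'I_n) : (size s < n)%N -> exists i, i \notin s.
Proof.
move=> lt_s; have /subsetPn[i _ si] : ~~ ([set: 'I_n] \subset s).
  apply/negP=> /subset_leq_card; rewrite cardsT card_ord leqNgt.
  by rewrite (leq_ltn_trans (card_size s)).
by exists i.
Qed.

Lemma root_vec_perm g x y y' x1 y1 y2 : g (x, y) = (x1, y1) ->
    g (x, y') = (x1, y2) ->
  [ffun z => root_vec x y y' ((g^-1)%g z)] = root_vec x1 y1 y2.
Proof.
move=> gy gy'; apply/ffunP=> z; rewrite !ffunE -gy -gy'.
by rewrite !permV_eq.
Qed.

(** If g is trivial on the module, then for v = e_z - e_z' with z, z' in one
    block, v g - v is constant on each block. A block has at least 5 points, so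
    v g - v vanishes somewhere in it, hence everywhere in it; thus g z = z or
    g z' = z. If g moved z, the second alternative would hold for every z', and
    g would not be injective. *)
Lemma heart_faithful : (2 < q)%N -> mx_faithful heart_repr.
Proof.
move=> q_gt2; apply/fintype.subsetP=> g /rkerP[Gg g1].
rewrite inE; apply/eqP/permP=> -[x y0]; rewrite perm1.
apply/eqP/negPn/negP=> neq_gz.
have swap y : y != y0 -> g (x, y) = (x, y0).
  move=> neq_y; pose v := root_vec x y0 y.
  have v0 : sum_zero v by apply: sum_zero_root.
  have gv0 := sum_zero_wperm (fun=> 1) (blockG Gg) v0.
  have cv : block_const (wperm (fun=> 1) g v - v).
    apply: heart_proj_eq0; first exact: sum_zeroB.
    by rewrite linearB /= wperm1E -heart_reprE // g1 mulmx1 subrr.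
  (* a fifth point of the block, where v and v g both vanish *)
  have [|y3] := @exists_notin _ [:: y0; y; (g (x, y0)).2; (g (x, y)).2].
    by rewrite !ltnS.
  rewrite !inE !negb_or => /and4P[y30 y3y y3g y3g'].
  have := cv x y0 y3; rewrite wperm1E.
  rewrite !ffunE !permV_eq.
  have ne z : y3 != z.2 -> ((x, y3) == z) = false.
    by case: z => x' y' /=; rewrite xpair_eqE andbC => /negPf->.
  rewrite !ne //= !xpair_eqE !eqxx (eq_sym y0) (negPf neq_y) /= !subr0.
  rewrite (eq_sym _ (g _)) (negPf neq_gz) sub0r.
  have [-> //|_] := eqVneq.
  by rewrite mulr0n oppr0 sub0r => /eqP; rewrite oppr_eq0 oner_eq0.
have [|y1] := @exists_notin _ [:: y0]; first by [].
have [|y2] := @exists_notin _ [:: y0; y1].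
  by rewrite !ltnS (leq_trans _ q_gt2).
rewrite !inE !negb_or => /andP[y20 y21] y10; case/eqP: y21.
by have := swap _ y20; rewrite -(swap _ y10) => /perm_inj[].
Qed.

(** A vector v that is not constant on some block gives v - v t, a nonzero
    multiple of e_z - e_z', where t is the transposition of z and z'. The group
    moves it to all differences of two points in one block, and these span. *)
Lemma heart_irreducible : (0 < q)%N -> (0 < #|X|)%N ->
    (forall x x', exists2 g, g \in G & forall y, g (x, y) = (x', y)) ->
  mx_irreducible heart_repr.
Proof.
move=> q_gt0 X_gt0 transG; apply/mx_irrP; split=> [|U modU nzU].
  by rewrite card_prod card_ord muln_gt0 X_gt0.
have mulU g v : g \in G -> sum_zero v -> (heart_proj v <= U)%MS ->
    (heart_proj [ffun z => v ((g^-1)%g z)] <= U)%MS.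
  move=> Gg v0 Uv; rewrite -heart_reprE //.
  exact: submx_trans (submxMr _ Uv) (mxmoduleP modU g Gg).
have [x [y [y' [neq_y Uy]]]] : exists x y y',
    y != y' /\ (heart_proj (root_vec x y y') <= U)%MS.
  have [w wU nzw] := rowV0Pn nzU.
  have [v v0 def_w] : exists2 v, sum_zero v & heart_proj v = w.
    by exists (heart_lift w); [apply: sum_zero_lift | apply: heart_liftK].
  have /existsP[x /existsP[y /existsP[y' neq_v]]] :
      [exists x, exists y, exists y', v (x, y) != v (x, y')].
    apply: contraR nzw => /existsPn cv; rewrite -def_w.
    apply/eqP/heart_proj_const=> x y y'; apply/eqP/negPn.
    by have /existsPn/(_ y)/existsPn/(_ y') := cv x.
  have neq_y : y != y' by apply: contraNneq neq_v => ->.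
  exists x, y, y'; split=> //.
  have Gt := tpermG x y y'.
  have := mulU _ v Gt v0; rewrite def_w => /(_ wU) wtU.
  pose c := v (x, y) - v (x, y').
  have nzc : c != 0 by rewrite subr_eq0.
  rewrite -[heart_proj _](scalerK nzc) scalemx_sub // -linearZ /=.
  have -> : c *: root_vec x y y'
          = v - [ffun z => v ((tperm (x, y) (x, y'))^-1%g z)].
    apply/ffunP=> z; rewrite !ffunE tpermV /GRing.scale /=.
    have [->|->|/eqP/negPf-> /eqP/negPf->] := tpermP.
    - by rewrite eqxx xpair_eqE eqxx (negPf neq_y) subr0 mulr1.
    - by rewrite eqxx xpair_eqE eqxx eq_sym (negPf neq_y) sub0r mulrN1 opprB.
    by rewrite !subrr mulr0.
  by rewrite linearB /= def_w addmx_sub // eqmx_opp.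
have Ux x' : (heart_proj (root_vec x' y y') <= U)%MS.
  have [g Gg gx] := transG x x'.
  by rewrite -(root_vec_perm (gx y) (gx y')) mulU //; apply: sum_zero_root.
have Uxy x' y1 : (heart_proj (root_vec x' y1 y') <= U)%MS.
  have [->|neq_y1] := eqVneq y1 y'.
    rewrite (_ : root_vec _ _ _ = 0) ?linear0 ?sub0mx //.
    by apply/ffunP=> z; rewrite !ffunE subrr.
  have t1 : tperm (x', y) (x', y1) (x', y) = (x', y1) by rewrite tpermL.
  have t2 : tperm (x', y) (x', y1) (x', y') = (x', y').
    by rewrite tpermD // xpair_eqE eqxx.
  by rewrite -(root_vec_perm t1 t2) mulU //; apply: sum_zero_root.
rewrite -sub1mx; apply/row_subP=> i.
have [v v0 <-] : exists2 v, sum_zero v & heart_proj v = row i 1%:M.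
  exists (heart_lift (row i 1%:M)); first exact: sum_zero_lift.
  exact: heart_liftK.
have -> : v = \sum_z v z *: root_vec z.1 z.2 y'.
  apply/ffunP=> z; rewrite sum_ffunE.
  under eq_bigr => t _ do
    rewrite !ffunE /GRing.scale /= mulrBr -surjective_pairing.
  rewrite sumrB (bigD1 z) //= eqxx mulr1 big1 ?addr0 => [|t]; last first.
    by rewrite eq_sym => /negPf->; rewrite mulr0.
  rewrite (eq_bigr (fun t => v (t.1, t.2) * (z == (t.1, y'))%:R)) => [|[]//].
  rewrite -(pair_bigA _ (fun a b => v (a, b) * (z == (a, y'))%:R)) /=.
  by rewrite big1 ?subr0 // => a _; rewrite -mulr_suml v0 mul0r.
rewrite linear_sum summx_sub // => z _.
by rewrite linearZ scalemx_sub.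
Qed.

Definition base_vec : {ffun Z -> F^o} := [ffun z => (z.2 == ord0)%:R].

(** The vector base_vec, with one point in each block, has block sums 1: it lies
    outside the module, but its translates differ by elements of the module. *)
Definition section_cocycle g : 'rV[F]_dimH :=
  heart_proj (wperm (fun=> 1) g base_vec - base_vec).

Lemma block_sum_base x : \sum_y base_vec (x, y) = 1.
Proof.
under eq_bigr do rewrite ffunE.
by rewrite (bigD1 ord0) //= big1 ?addr0 // => y /negPf->.
Qed.

Lemma sum_zero_base g : block_perm g ->
  sum_zero (wperm (fun=> 1) g base_vec - base_vec).
Proof.
move=> bg x; rewrite block_sumB block_sum_wperm // !block_sum_base mul1r.
exact: subrr.
Qed.

Lemma section_cocycleM g h : g \in G -> h \in G ->
  section_cocycle (g * h)%g
    = section_cocycle g *m heart_repr h + section_cocycle h.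
Proof.
move=> /blockG bg /blockG bh.
rewrite heart_mxE //; last exact: sum_zero_base.
rewrite /section_cocycle -linearD /=; congr heart_proj.
rewrite [wperm _ h _]linearB /= wpermM // addrA subrK; congr (_ - _).
by apply/ffunP=> z; rewrite !ffunE mulr1.
Qed.

(** The difference of r and its image under a transposition vanishes at any
    third point of the block. *)
Lemma tperm_const r x : (0 < q)%N ->
    (forall y y', let g := tperm (x, y) (x, y') in forall y1 y2,
       (wperm (fun=> 1) g r - r) (x, y1) = (wperm (fun=> 1) g r - r) (x, y2)) ->
  forall y y', r (x, y) = r (x, y').
Proof.
move=> q_gt0 rP y y'; have [|y3] := @exists_notin _ [:: y; y'].
  by rewrite !ltnS.
rewrite !inE negb_or => /andP[y3y y3y'].
have := rP y y' y y3; rewrite !ffunE !mul1r !tpermV tpermL.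
rewrite tpermD ?xpair_eqE ?eqxx 1?eq_sym // subrr.
by move/subr0_eq.
Qed.

(** If w makes a multiple a of the cocycle bound on the symmetric group of a
    block, then a base_vec + w is fixed by it modulo constants, hence constant
    on the block; its block sum is a on the one hand, (q+2) c = 0 on the
    other. *)
Lemma section_cocycle_nontrivial x (a : F) (w : 'rV[F]_dimH) : (0 < q)%N ->
    (forall y y', let g := tperm (x, y) (x, y') in
       a *: section_cocycle g *m block_proj x
         = w *m (1%:M - heart_repr g) *m block_proj x) ->
  a = 0.
Proof.
move=> q_gt0 aw; pose v := heart_lift w; pose r := a *: base_vec + v.
have v0 : sum_zero v by apply: sum_zero_lift.
have r_sum x1 : \sum_y r (x1, y) = a.
  by rewrite block_sumD block_sum_base v0 addr0 mulr1.
have := r_sum x; rewrite (eq_bigr (fun=> r (x, ord0))) => [|y _].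
  by rewrite sumr_const card_ord -mulr_natr q2F mulr0.
apply: tperm_const => // {}y y' g.
have bg : block_perm g by apply/blockG/tpermG.
have {aw} := aw y y'; rewrite /= -/g => /eqP; rewrite -subr_eq0 => /eqP aw.
apply: block_proj_eq0.
  by move=> x'; rewrite block_sumB block_sum_wperm // !r_sum mul1r subrr.
rewrite -[RHS]aw -mulmxBl; congr (_ *m _).
rewrite mulmxBr mulmx1 -[w]heart_liftK -/v heart_mxE //.
rewrite /section_cocycle -linearZ -!linearB /=; congr heart_proj.
by rewrite linearD linearZ /= scalerBr opprB opprD [in RHS]addrACA.
Qed.

End Representation.
End Heart.

(** * The group *)

Section BlockGroup.

Variables (A : finGroupType) (p q : nat).

Local Notation X := (A * 'F_p)%type.
Local Notation Z := (X * 'I_q.+2)%type.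
Implicit Types (g h : {perm Z}) (a c : A).

(** For g in the group below, shift g and twist g are the parameters s and t of
    (a, b, y) |-> (a s, b + t a, ...); they are read off at the points of
    coordinates b = 0 and y = 0. *)
Definition shift g : A := (g ((1%g, 0), ord0)).1.1.
Definition twist g a : 'F_p := (g ((a, 0), ord0)).1.2.

Definition tower_set : {set {perm Z}} :=
  [set g : {perm Z} | [forall z : Z,
     (g z).1 == ((z.1.1 * shift g)%g, z.1.2 + twist g z.1.1)]].

Lemma towerP g :
  reflect (forall a b y, (g ((a, b), y)).1 = ((a * shift g)%g, b + twist g a))
          (g \in tower_set).
Proof.
rewrite inE; apply: (iffP forallP) => [gP a b y | gP [[a b] y]].
  exact/eqP/(gP ((a, b), y)).
exact/eqP/gP.
Qed.

Lemma tower_intro g s (t : A -> 'F_p) :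
    (forall a b y, (g ((a, b), y)).1 = ((a * s)%g, b + t a)) ->
  [/\ g \in tower_set, shift g = s & twist g =1 t].
Proof.
move=> gP; have gs : shift g = s by rewrite /shift gP mul1g.
have gt : twist g =1 t by move=> a; rewrite /twist gP add0r.
by split=> //; apply/towerP => a b y; rewrite gP gs gt.
Qed.

Lemma towerM g h : g \in tower_set -> h \in tower_set ->
  [/\ (g * h)%g \in tower_set, shift (g * h)%g = (shift g * shift h)%g
    & forall a, twist (g * h)%g a = twist g a + twist h (a * shift g)%g].
Proof.
move=> /towerP gP /towerP hP; apply: tower_intro => a b y.
rewrite permM; case: (g _) (gP a b y) => x y' /= ->.
by rewrite hP mulgA addrA.
Qed.

Lemma tower_group_set : group_set tower_set.
Proof.
apply/group_setP; split=> [|g h Gg Gh]; last by case: (towerM Gg Gh).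
suffices: [/\ 1%g \in tower_set, shift 1%g = 1%g & twist 1%g =1 fun=> 0].
  by case.
by apply: tower_intro => a b y; rewrite perm1 mulg1 addr0.
Qed.
Canonical tower_group := Group tower_group_set.

Lemma tower_block : {in tower_group, forall g, block_perm g}.
Proof.
move=> g /towerP gP [[a b] y] [[a' b'] y']; rewrite !gP !xpair_eqE.
rewrite (inj_eq (mulIg _)); have [->|] //= := eqVneq.
by rewrite (inj_eq (addIr _)).
Qed.

Lemma on_blocks_tower g x : g \in tower_group ->
  on_blocks g x = ((x.1 * shift g)%g, x.2 + twist g x.1).
Proof. by move=> /towerP gP; case: x => a b; rewrite /on_blocks gP. Qed.

Definition slide_fun s (t : A -> 'F_p) (z : Z) : Z :=
  (((z.1.1 * s)%g, z.1.2 + t z.1.1), z.2).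

Lemma slide_inj s t : injective (slide_fun s t).
Proof.
move=> [[a b] y] [[a' b'] y'] /eqP; rewrite !xpair_eqE /= (inj_eq (mulIg s)).
by case/andP=> /andP[/eqP-> /eqP/addIr->] /eqP->.
Qed.

Definition slide s t : {perm Z} := perm (@slide_inj s t).

Lemma slideE s t a b y : slide s t ((a, b), y) = (((a * s)%g, b + t a), y).
Proof. by rewrite permE. Qed.

Lemma slideP s t :
  [/\ slide s t \in tower_group, shift (slide s t) = s
    & twist (slide s t) =1 t].
Proof. by apply: tower_intro => a b y; rewrite slideE. Qed.

Lemma tower_transitive (x x' : X) :
  exists2 g, g \in tower_group & forall y : 'I_q.+2, g (x, y) = (x', y).
Proof.
case: x x' => a b [a' b']; exists (slide (a^-1 * a')%g (fun=> b' - b)).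
  by case: (slideP (a^-1 * a')%g (fun=> b' - b)).
by move=> y; rewrite slideE mulKVg addrC subrK.
Qed.

Lemma tower_tpermP (x : X) (y y' : 'I_q.+2) (g := tperm (x, y) (x, y')) :
  [/\ g \in tower_group, shift g = 1%g & twist g =1 fun=> 0].
Proof.
apply: tower_intro => a b z; rewrite mulg1 addr0.
by rewrite /g; case: tpermP => [[-> _]|[-> _]|].
Qed.

(** The elements e_c detecting the derivation T_c. *)
Definition shear c := slide 1%g (fun a => (a == c)%:R).

Lemma shearP c :
  [/\ shear c \in tower_group, shift (shear c) = 1%g
    & forall a, twist (shear c) a = (a == c)%:R].
Proof. exact: slideP. Qed.

Lemma shear_fix c a b y : a != c -> shear c ((a, b), y) = ((a, b), y).
Proof. by move=> /negPf ac; rewrite slideE ac mulg1 addr0. Qed.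

Lemma shear_commute c c' : commute (shear c) (shear c').
Proof.
by apply/permP=> -[[a b] y]; rewrite !permM !slideE !mulg1 addrAC.
Qed.

Lemma shear_tperm_commute c a b y y' : a != c ->
  commute (shear c) (tperm ((a, b), y) ((a, b), y')).
Proof.
move=> ac; apply/commgP/eqP; rewrite commgEr.
by rewrite tpermV tpermJ !shear_fix // tperm2.
Qed.

End BlockGroup.

(** * The cohomology classes *)

Section Classes.

Variables (F : fieldType) (p : nat) (charFp : p \in [pchar F]).
Variables (A : finGroupType) (q : nat).
Hypothesis q2F : q.+2%:R = 0 :> F.

Local Notation X := (A * 'F_p)%type.
Local Notation Z := (X * 'I_q.+2)%type.
Local Notation G := (tower_group A p q).
Local Notation M := (heart_repr q2F (@tower_block A p q)).

Definition Fp_embed (b : 'F_p) : F := (val b)%:R.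

Lemma Fp_embedD : {morph Fp_embed : b c / b + c}.
Proof.
move=> b c; rewrite /Fp_embed /=.
rewrite [X in (_ %% X)%N]Fp_cast ?(pcharf_prime charFp) //.
by rewrite GRing.natr_mod_pchar // natrD.
Qed.

Lemma Fp_embed_bool (b : bool) : Fp_embed b%:R = b%:R.
Proof. by case: b; rewrite /Fp_embed //= modn_small. Qed.

(** By towerM, twist is a cocycle with values in the functions on A, on which
    g acts through right translation by shift g. Left translation by c commutes
    with this action, so each c gives a further cocycle. *)
Definition twist_mx c (g : subg_of G) : 'M[F]_#|{: X * 'I_q}| :=
  heart_mx (fun x => Fp_embed (twist (sgval g) (c * x.1)%g)) (sgval g).

Lemma twist_derivation c : mx_derivation M (twist_mx c).
Proof.
move=> g h; rewrite /twist_mx /=.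
have [Gg Gh] := (subgP g, subgP h); have [_ _ tw] := towerM Gg Gh.
rewrite !heart_mxM //; try exact: tower_block.
rewrite -heart_mxD; apply: eq_heart_mx => // x.
by rewrite on_blocks_tower //= tw Fp_embedD mulr1 mul1r mulgA.
Qed.

Definition section_cochain : cochain F G #|{: X * 'I_q}| 1 :=
  [ffun g : {ffun 'I_1 -> subg_of G} => section_cocycle F (sgval (g ord0))].

Lemma section_cochain_cocycle : coboundary M section_cochain = 0.
Proof.
apply/ffunP=> g; rewrite !ffunE !big_ord_recl big_ord0 !ffunE /=.
have -> : g ord_max = g (lift ord0 ord0) by congr (g _); apply: val_inj.
set x := g (widen_ord _ _); set y := g _; rewrite /bump leqnn.
rewrite (section_cocycleM q2F (@tower_block A p q)) ?subgP //.
rewrite expr0 expr1 sqrrN expr1n !scale1r scaleN1r addr0 opprD.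
by rewrite addrCA addrN addr0 addNr.
Qed.

Fixpoint cup_class (c : nat -> A) n : cochain F G #|{: X * 'I_q}| n.+1 :=
  if n is m.+1 then cup (cup_class c m) (twist_mx (c m)) else section_cochain.

Lemma cup_class_cocycle c n : coboundary M (cup_class c n) = 0.
Proof.
elim: n => [|n IHn]; first exact: section_cochain_cocycle.
rewrite coboundary_cup ?IHn; last exact: twist_derivation.
by apply/ffunP=> g; rewrite !ffunE mul0mx.
Qed.

(** If each factor T_c(g) sends P to a scalar multiple of P, then the product
    collapses from its right end. *)
Lemma cup_class_mulmx (c : nat -> A) n (g : 'I_n.+1 -> subg_of G)
    (P : 'M[F]_#|{: X * 'I_q}|) (mu : 'I_n -> F) :
    (forall i : 'I_n, twist_mx (c i) (g (lift ord0 i)) *m P = mu i *: P) ->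
  cup_class c n (finfun g) *m P
    = (\prod_i mu i) *: (section_cocycle F (sgval (g ord0)) *m P).
Proof.
elim: n g mu => [|n IHn] g mu gP.
  by rewrite big_ord0 scale1r !ffunE.
rewrite [cup_class _ _]/= cupE ffunE -mulmxA.
have -> : g ord_max = g (lift ord0 ord_max) by congr (g _); apply: val_inj.
rewrite (gP ord_max) -scalemxAr big_ord_recr /= mulrC -scalerA.
have -> : face n.+2 [ffun i => g i]
        = finfun (fun i => g (widen_ord (leqnSn n.+1) i)).
  by apply/ffunP=> i; rewrite face_last !ffunE.
rewrite (IHn _ (fun i => mu (widen_ord (leqnSn n) i))).
  by congr (_ *: (_ *: (section_cocycle F (sgval (g _)) *m _))); apply: val_inj.
move=> i; rewrite -gP /=; congr (twist_mx _ (g _) *m _); exact: val_inj.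
Qed.

End Classes.

(** * Independence of the classes *)

Section LowerBound.

Variables (F : fieldType) (p : nat) (charFp : p \in [pchar F]).
Variables (A : finGroupType) (q : nat).
Hypothesis q2F : q.+2%:R = 0 :> F.
Hypothesis q_gt0 : (0 < q)%N.

Local Notation X := (A * 'F_p)%type.
Local Notation Z := (X * 'I_q.+2)%type.
Local Notation G := (tower_group A p q).
Local Notation M := (heart_repr q2F (@tower_block A p q)).
Local Notation x0 := ((1%g, 0) : X).
Local Notation B := (block_proj F q x0).

Definition test_elt (b : nat -> A) (l : {perm Z}) K (j : 'I_K.+1) : subg_of G :=
  subg G (if unlift ord0 j is Some i then shear p q (b i) else l).

Lemma block_proj_repr g : g \in G -> (forall y, g (x0, y) = (x0, y)) ->
  M g *m B = B.
Proof.
by move=> Gg gx; rewrite heart_mx_fix ?scale1r //; apply: tower_block.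
Qed.

Lemma sgval_test_elt0 b l K (j : 'I_K.+1) : l \in G -> j = ord0 ->
  sgval (test_elt b l j) = l.
Proof. by move=> Gl ->; rewrite /test_elt unlift_none subgK. Qed.

Lemma sgval_test_eltS b l K (i : 'I_K) :
  sgval (test_elt b l (lift ord0 i)) = shear p q (b i).
Proof. by rewrite /test_elt liftK subgK //; case: (shearP p q (b i)). Qed.

Lemma shear_fix_x0 c y : c != 1%g -> shear p q c (x0, y) = (x0, y).
Proof. by move=> nc; apply: shear_fix; rewrite eq_sym. Qed.

(** On the summand of the block x0, T_(c i) acts as 0 at the transposition l
    and as the scalar [c i = b j] at e_(b j). An order s of the arguments
    contributes only if each factor of index i receives some e_(b j) with
    c i = b j, and then j = i by hypothesis: only s = 1 is left. *)
Lemma alternation_cup_class (b c : nat -> A) K y y'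
    (l := tperm (x0, y) (x0, y')) :
    (forall j : 'I_K, b j != 1%g) ->
    (forall i j : 'I_K, c i = b j -> i = j) ->
  alternation (cup_class F p q c K) (test_elt b l (K := K)) *m B
    = [forall j : 'I_K, c j == b j]%:R *: (section_cocycle F l *m B).
Proof.
move=> nb cb; have [Gl sl tl] := tower_tpermP x0 y y'.
pose mu (s : 'S_K.+1) (i : 'I_K) : F :=
  if unlift ord0 (s (lift ord0 i)) is Some j then (c i == b j)%:R else 0.
have muP (s : 'S_K.+1) (i : 'I_K) :
    twist_mx F (c i) (test_elt b l (s (lift ord0 i))) *m B = mu s i *: B.
  rewrite /twist_mx /mu; case: unliftP => [j ->|s0].
    rewrite sgval_test_eltS; have [Gb _ tb] := shearP p q (b j).
    rewrite (heart_mx_fix q2F); [|exact: (tower_block Gb)|]; last first.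
      by move=> z; apply: shear_fix_x0.
    by rewrite mulg1 tb Fp_embed_bool.
  rewrite sgval_test_elt0 // scale0r (eq_heart_mx (psi := fun=> 0)) => [|x].
    by rewrite heart_mx0 mul0mx.
  by rewrite tl -[0]/(false%:R) Fp_embed_bool.
rewrite mulmx_suml.
transitivity (\sum_(s : 'S_K.+1) (-1) ^+ s *: ((\prod_i mu s i) *:
   (section_cocycle F (sgval (test_elt b l (s ord0))) *m B))).
  apply: eq_bigr => s _; rewrite -scalemxAl; congr (_ *: _).
  exact: cup_class_mulmx (muP s).
rewrite (bigD1 1%g) //= odd_perm1 expr0 scale1r perm1.
rewrite [X in _ + X]big1 ?addr0 => [|s s1].
  rewrite sgval_test_elt0 //; congr (_ *: _).
  have mu1 i : mu 1%g i = (c i == b i)%:R by rewrite /mu perm1 liftK.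
  have [/forallP cb1|/forallPn[i ni]] := boolP [forall j : 'I_K, c j == b j].
    by rewrite big1 // => i _; rewrite mu1 cb1.
  by rewrite (bigD1 i) //= mu1 (negPf ni) mul0r.
have /existsP[i si] : [exists i, s (lift ord0 i) != lift ord0 i].
  apply: contraR s1 => /existsPn sfix; apply/eqP/permP=> j; rewrite perm1.
  have {}sfix i : s (lift ord0 i) = lift ord0 i by apply/eqP/negPn.
  case: (unliftP ord0 j) => [i -> //|->].
  case: (unliftP ord0 (s ord0)) => [i|//].
  by rewrite -{1}(sfix i) => /perm_inj.
have mu0 : mu s i = 0.
  rewrite /mu; case: unliftP => // j sj; case: eqP => // /cb eq_ij.
  by rewrite sj eq_ij eqxx in si.
by rewrite (bigD1 i) //= mu0 mul0r scale0r scaler0.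
Qed.

Lemma tower_cohomology_ge (I : finType) K (c : I -> nat -> A) :
    (forall i (j : 'I_K), c i j != 1%g) ->
    (forall i i' (j j' : 'I_K), c i j = c i' j' -> j = j') ->
    (forall i i', (forall j : 'I_K, c i j = c i' j) -> i = i') ->
  (#|I| <= dim_cohomology M K.+1)%N.
Proof.
move=> c1 c_stripe c_inj.
pose f i := cup_class F p q (c i) K.
apply: (@dim_cohomology_ge _ _ _ _ _ _ _ f) => [i|a h def_h i].
  exact: cup_class_cocycle.
pose t l : 'I_K.+1 -> subg_of G := @test_elt (c i) l K.
(* The vector w may be computed with l = 1: in the arrangements that keep l in
   the first place, the argument of h does not involve l. *)
pose w := \sum_(s : 'S_K.+1 | s ord0 == ord0)
   (-1) ^+ s *: h [ffun j => t 1%g (s (lift ord0 j))].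
have tpermG x y y' : tperm (x, y) (x, y') \in G by case: (tower_tpermP x y y').
apply: (@section_cocycle_nontrivial F _ q q2F _ (@tower_block A p q) tpermG x0
         (a i) w) => // y y' l /=.
have [Gl sl tl] := tower_tpermP x0 y y'.
have commt j j' : commute (t l j) (t l j').
  apply: val_inj; rewrite /=.
  case: (unliftP ord0 j) (unliftP ord0 j') => [k|] -> [k'|] ->;
    rewrite ?sgval_test_eltS ?[sgval (t l ord0)]sgval_test_elt0 //.
  - exact: shear_commute.
  - by apply: shear_tperm_commute; rewrite eq_sym.
  by apply/esym/shear_tperm_commute; rewrite eq_sym.
have := congr1 (fun f => alternation f (t l) *m B) def_h.
rewrite /= alternation_sum (alternation_coboundary _ _ commt) !mulmx_suml.
rewrite (bigD1 i) //= big1 ?addr0 => [|i' neq_i]; last first.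
  rewrite -scalemxAl alternation_cup_class //; last first.
    by move=> j j'; apply: c_stripe.
  rewrite (_ : [forall j : 'I_K, c i' j == c i j] = false) ?scale0r ?scaler0 //.
  by apply: contraNF neq_i => /forallP eq_c; apply/eqP/c_inj => j; apply/eqP.
rewrite -scalemxAl alternation_cup_class //; last first.
  by move=> j j'; apply: c_stripe.
have -> : [forall j : 'I_K, c i j == c i j] by apply/forallP.
rewrite scale1r.
rewrite -scalemxAl => ->.
(* Where l is not in the first place, a shear is, which is trivial on x0. *)
rewrite (bigID (fun s : 'S_K.+1 => s ord0 == ord0)) /= addrC.
rewrite big1 ?add0r => [|s s0].
  apply: eq_bigr => s /eqP s0.
  rewrite -!scalemxAl; congr (_ *: (h _ *m (_ - M _) *m _)).
    apply/ffunP=> j; rewrite !ffunE /t /test_elt; case: unliftP => // s0j.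
    by have := perm_inj (etrans s0j (esym s0)).
  exact: sgval_test_elt0.
rewrite -!scalemxAl -mulmxA; case: (unliftP ord0 (s ord0)) s0 => [j|] -> // _.
have [Gj _ _] := shearP p q (c i j).
rewrite /t sgval_test_eltS mulmxBl mul1mx block_proj_repr //.
  by rewrite subrr mulmx0 scaler0.
by move=> z; apply: shear_fix_x0.
Qed.

End LowerBound.

(** * The families of indices and the asymptotics *)

Section Stripes.

Variables (K N : nat).
Local Notation A := ('I_K.+1 * 'I_N.+1)%type.

(** The first coordinate records the position, so that distinct positions have
    distinct indices; it is never 0, so that the shears fix the block x0. *)
Definition stripe (f : {ffun 'I_K -> 'I_N.+1}) (n : nat) : A :=
  (inord n.+1, if insub n is Some j then f j else ord0).

Lemma stripe_fst f (j : 'I_K) : val (stripe f j).1 = j.+1.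
Proof. by rewrite /= inordK // ltnS. Qed.

Lemma stripe_neq1 f (j : 'I_K) : stripe f j != 1%g.
Proof.
by apply/eqP=> /(congr1 (fun a : A => val a.1)); rewrite stripe_fst.
Qed.

Lemma stripe_index f f' (j j' : 'I_K) : stripe f j = stripe f' j' -> j = j'.
Proof.
move/(congr1 (fun a : A => val a.1)); rewrite !stripe_fst => -[].
exact: val_inj.
Qed.

Lemma stripe_inj f f' : (forall j : 'I_K, stripe f j = stripe f' j) -> f = f'.
Proof.
move=> eq_f; apply/ffunP=> j.
by have := congr1 snd (eq_f j); rewrite /= (valK j).
Qed.

End Stripes.

Local Open Scope classical_set_scope.
Local Open Scope ring_scope.

Theorem theoremG (R : realType) (p k : nat) (p_prime : prime p)
    (k_gt0 : (0 < k)%N) :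
  exists2 e : R, 0 < e &
    forall F : closedFieldType, p \in [pchar F] ->
    exists (gT : nat -> finGroupType) (G : forall i, {group gT i})
           (d : nat -> nat) (M : forall i, mx_representation F (G i) (d i)),
      [/\ forall i, mx_irreducible (M i) /\ mx_faithful (M i),
          (d i)%:R @[i --> \oo] --> +oo_R,
          forall i, e * (d i)%:R ^+ (k - 1) <= (dim_cohomology (M i) k)%:R
        & (3 <= k)%N ->
          ((dim_cohomology (M i) k)%:R / (d i)%:R) @[i --> \oo] --> +oo_R].
Proof.
case: k k_gt0 => // K _; rewrite subn1 /=.
have p_gt1 := prime_gt1 p_prime.
(* Blocks of 3p points: a multiple of p, and at least 5. *)
pose q := (3 * p - 2)%N; have q2 : q.+2 = (3 * p)%N by rewrite /q; lia.
have q_gt2 : (2 < q)%N by rewrite /q; lia.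
pose m := (K.+1 * p * q)%N; have m_gt0 : (0 < m)%N by rewrite /m; nia.
exists (m%:R ^- K) => [|F charFp]; first by rewrite invr_gt0 exprn_gt0 ?ltr0n.
have q2F : q.+2%:R = 0 :> F by rewrite q2 natrM (pcharf0 charFp) mulr0.
pose A i : finGroupType := ('I_K.+1 * 'I_i.+1)%type.
pose d i := #|{: A i * 'F_p * 'I_q}|.
have dE i : d i = (i.+1 * m)%N.
  by rewrite /d !card_prod !card_ord Fp_cast // /m; nia.
pose M i := heart_repr q2F (@tower_block (A i) p q).
have lower i : m%:R ^- K * (d i)%:R ^+ K <= (dim_cohomology (M i) K.+1)%:R :> R.
  rewrite dE natrM exprMn mulrCA mulVf ?expf_neq0 ?pnatr_eq0 -?lt0n // mulr1.
  have cardI : #|{ffun 'I_K -> 'I_i.+1}| = (i.+1 ^ K)%N.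
    by rewrite card_ffun !card_ord.
  rewrite -natrX ler_nat -cardI.
  apply: (@tower_cohomology_ge F p charFp (A i) q q2F _ _ K (@stripe K i)).
  - exact: ltn_trans q_gt2.
  - exact: stripe_neq1.
  - exact: stripe_index.
  exact: stripe_inj.
have d_ge i : (i <= d i)%N by rewrite dE; nia.
have d_gt0 i : 0 < (d i)%:R :> R by rewrite ltr0n dE muln_gt0.
have d_cvg : (d i)%:R @[i --> \oo] --> +oo_R.
  by apply: ger_cvgy cvgr_idn; apply: nearW => i; rewrite ler_nat.
exists (fun i => {perm (A i * 'F_p * 'I_q.+2)}).
exists (fun i => tower_group (A i) p q), d, M.
split=> [i|//|//|k_ge3].
  split; last exact: heart_faithful.
  apply: heart_irreducible.
  - by move=> x y y'; case: (tower_tpermP x y y').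
  - exact: ltn_trans q_gt2.
  - by apply/card_gt0P; exists (1%g, 0).
  exact: tower_transitive.
have e_gt0 : 0 < m%:R ^- K :> R by rewrite invr_gt0 exprn_gt0 ?ltr0n.
have ed_cvg : m%:R ^- K * (d i)%:R @[i --> \oo] --> +oo_R.
  exact: (@gt0_cvgMry R ((fun i => (d i)%:R : R) @ \oo) _ _ id e_gt0 d_cvg).
apply: ger_cvgy ed_cvg; apply: nearW => i.
rewrite ler_pdivlMr // -mulrA -expr2; apply: le_trans (lower i).
rewrite ler_pM2l //.
by rewrite ler_weXn2l // ler1n dE muln_gt0.
Qed.
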